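(* Let $N\ge3$ and let $V\colon\mathbb{R}^N\to\mathbb{R}$ be continuous with $\inf_{\mathbb{R}^N}V>0$. Suppose that there exist positive constants $c_1,c_2,m$ and a sequence $\{x_n\}_n$ in $\mathbb{R}^N$ such that $V(x_n)\to+\infty$ and \[ c_1V(x_n)\le V(x)\le c_2V(x_n)\quad\text{for all } x\in B_{m/\sqrt{V(x_n)}}(x_n)\text{ and all }n . \] Then $H^1_V(\mathbb{R}^N)\setminus L^\tau_V(\mathbb{R}^N)\neq\emptyset$ for every $\tau>2$.
   Context: $H^1_V(\mathbb{R}^N)$ is the completion of $C_0^\infty(\mathbb{R}^N)$ with respect to the norm $\|u\|_V=\left(\int_{\mathbb{R}^N}(|\nabla u|^2+V(x)|u|^2)\,dx\right)^{1/2}$. $L^\tau_V(\mathbb{R}^N)$ is the space of measurable $u$ with $\int_{\mathbb{R}^N}V(x)|u|^\tau dx<+\infty$. $B_r(x)$ denotes the open ball of radius $r$ centered at $x$. *)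

(* Defs.v *)
From HB Require Import structures.
From mathcomp Require Import all_boot all_order all_algebra.
From mathcomp Require Import all_classical all_reals all_analysis.
Set Implicit Arguments. Unset Strict Implicit. Unset Printing Implicit Defensive.
Import Order.TTheory GRing.Theory Num.Theory.
Import numFieldNormedType.Exports.
Local Open Scope classical_set_scope.
Local Open Scope ring_scope.

Section Defs.
Variable R : realType.

(* Euclidean norm on R^N (the library norm on matrices is the sup norm). *)
Definition eucl_norm N (x : 'rV[R]_N) : R := Num.sqrt (\sum_(i < N) x ord0 i ^+ 2).

Definition ebase N (i : 'I_N) : 'rV[R]_N := delta_mx ord0 i.

Fixpoint Ck N (k : nat) (f : 'rV[R]_N -> R) : Prop :=
  match k with
  | 0 => continuous f
  | k'.+1 => continuous f /\
      forall i : 'I_N, (forall x, derivable f x (ebase i)) /\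
                       Ck k' (fun x => derive f x (ebase i))
  end.

Definition smooth N (f : 'rV[R]_N -> R) : Prop := forall k, Ck k f.

Definition Cc_inf N (f : 'rV[R]_N -> R) : Prop :=
  smooth f /\ exists r : R, forall x, r < eucl_norm x -> f x = 0.

Definition grad_sq N (f : 'rV[R]_N -> R) (x : 'rV[R]_N) : R :=
  \sum_(i < N) (derive f x (ebase i)) ^+ 2.

(* Lebesgue integral over R^N of a nonnegative function, computed as the
   iterated integral over the coordinates (equal to the product-measure
   integral by Tonelli for nonnegative measurable integrands). *)
Fixpoint intRN (N : nat) : ('rV[R]_N -> \bar R) -> \bar R :=
  match N return ('rV[R]_N -> \bar R) -> \bar R with
  | 0 => fun g => g 0
  | n.+1 => fun g =>
      (\int[@lebesgue_measure R]_(t in [set: R])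
          intRN (fun y : 'rV[R]_n => g (row_mx (\row_(j < 1) t) y)))%E
  end.

(* Borel measurability on R^N, via the product sigma-algebra on N-tuples. *)
Definition measurableRN N (u : 'rV[R]_N -> R) : Prop :=
  measurable_fun [set: N.-tuple R] (fun t : N.-tuple R => u (\row_i tnth t i)).

Definition normV_sq N (V : 'rV[R]_N -> R) (f : 'rV[R]_N -> R) : \bar R :=
  intRN (fun x => (grad_sq f x + V x * f x ^+ 2)%:E).

(* H^1_V(R^N): completion of C_0^infty w.r.t. ||.||_V, its elements realised
   as functions u: u is the L^2_V-limit of a ||.||_V-Cauchy sequence of
   C_0^infty functions. *)
Definition H1V N (V : 'rV[R]_N -> R) (u : 'rV[R]_N -> R) : Prop :=
  measurableRN u /\
  exists phi : nat -> 'rV[R]_N -> R,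
    (forall k, Cc_inf (phi k)) /\
    (forall eps : R, 0 < eps -> exists K : nat, forall k l, (K <= k)%N -> (K <= l)%N ->
        (normV_sq V (fun x => (phi k x - phi l x)%R) <= eps%:E)%E) /\
    (forall eps : R, 0 < eps -> exists K : nat, forall k, (K <= k)%N ->
        (intRN (fun x => (V x * (phi k x - u x) ^+ 2)%R%:E) <= eps%:E)%E).

Definition LtauV N (V : 'rV[R]_N -> R) (tau : R) (u : 'rV[R]_N -> R) : Prop :=
  measurableRN u /\ (intRN (fun x => (V x * (`|u x| `^ tau))%R%:E) < +oo)%E.

End Defs.

(* Main.v *)
(* A smooth bump of height V(x_n)^alpha supported in the ball of centre x_n and
   radius m / sqrt (V(x_n)) has squared norm ||.||_V of order
   V(x_n)^(2 alpha - e) with e = N/2 - 1: both |grad u|^2 and V u^2 are of order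
   V(x_n)^(2 alpha + 1), on a volume of order V(x_n)^(-N/2).  Likewise the
   integral of V |u|^tau is of order V(x_n)^(tau alpha - e).  As e > 0 and
   tau > 2, some alpha satisfies 2 alpha < e < tau alpha, so that along a sparse
   subsequence the squared norms are summable while the integrals of V |u|^tau
   are unbounded.  Along such a subsequence the balls are moreover disjoint,
   since the two-sided bounds on V hold with incompatible values on them, and
   the sum of the bumps is the required function. *)

Require Import Defs.
From mathcomp Require Import all_boot all_order all_algebra.
From mathcomp Require Import all_classical all_reals all_analysis.
From mathcomp Require Import measurable_realfun ring lra.
Set Implicit Arguments.
Unset Strict Implicit.
Unset Printing Implicit Defensive.
Import Order.TTheory GRing.Theory Num.Theory.
Import numFieldNormedType.Exports.
Local Open Scope classical_set_scope.
Local Open Scope ring_scope.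

Lemma subsequence_near (P : nat -> nat -> Prop) (Q : nat -> nat -> Prop) :
  (forall k, \forall n \near \oo, P k n) ->
  (forall m, \forall n \near \oo, Q m n) ->
  exists f : nat -> nat,
    (forall k, P k (f k)) /\ forall i k, (i < k)%N -> Q (f i) (f k).
Proof.
move=> nearP nearQ.
have /choice[p Pp] k : exists p, forall n, (p <= n)%N -> P k n.
  by have [p _ Pp] := nearP k; exists p => n; exact: Pp.
have /choice[q Qq] m : exists q, forall n, (q <= n)%N -> Q m n.
  by have [q _ Qq] := nearQ m; exists q => n; exact: Qq.
pose f := fix f k : nat := if k is k'.+1
  then maxn (p k) (maxn (f k') (\max_(m < (f k').+1) q m)) else p 0%N.
have f_ndS k : (f k <= f k.+1)%N by rewrite !leq_max leqnn orbT.
have qf k m : (m <= f k)%N -> (q m <= f k.+1)%N.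
  rewrite -ltnS => mk.
  apply: leq_trans (@leq_bigmax _ (fun i : 'I__ => q i) (Ordinal mk)) _.
  by rewrite !leq_max leqnn !orbT.
exists f; split=> [[|k]|i [//|k] ik].
- exact: Pp.
- by apply: Pp; rewrite leq_max leqnn.
- by apply/Qq/qf; exact: (homo_leq leqnn leq_trans f_ndS).
Qed.

Lemma cvgry_powR {R : realType} {T : Type} {F : set_system T}
    {FF : Filter F} (v : T -> R) (p : R) :
  0 < p -> v @ F --> +oo -> (fun n => v n `^ p) @ F --> +oo.
Proof.
move=> p_gt0 /cvgryPge voo; apply/cvgryPge => A.
apply: filterS (voo (`|A| `^ p^-1)) => n Av; rewrite (le_trans (ler_norm A))//.
have -> : `|A| = (`|A| `^ p^-1) `^ p.
  by rewrite -powRrM mulVf ?gt_eqF// powRr1.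
have v_ge0 : 0 <= v n by apply: le_trans Av; exact: powR_ge0.
by rewrite ge0_ler_powR ?nnegrE ?powR_ge0// ltW.
Qed.

Lemma exists_middle_exponent {R : realFieldType} (e tau : R) :
  0 < e -> 2 < tau -> exists alpha, 2 * alpha < e /\ e < tau * alpha.
Proof.
move=> e_gt0 tau2; have tau_gt0 : 0 < tau by lra.
exists (e * (2^-1 + tau^-1) / 2); split.
  have : tau^-1 < 2^-1 by rewrite ltf_pV2 ?posrE.
  nra.
have -> : tau * (e * (2^-1 + tau^-1) / 2) = e * (tau / 4 + 2^-1).
  by field; rewrite gt_eqF.
nra.
Qed.

Lemma near_powR_bounds {R : realType} (v : nat -> R) (s e t : R) (k : nat) :
  v @ \oo --> +oo -> s < e -> e < t ->
  \forall n \near \oo,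
    v n `^ (s - e) <= 1 / (2 ^ k.+1)%:R /\ k%:R <= v n `^ (t - e).
Proof.
move=> voo se et.
have large_powR p A : 0 < p -> \forall n \near \oo, A <= v n `^ p.
  by move=> p_gt0; move: A; apply/cvgryPge; exact: cvgry_powR.
have two_gt0 : 0 < (2 ^ k.+1)%:R :> R by rewrite ltr0n expn_gt0.
near=> n; split; last by near: n; apply: large_powR; rewrite subr_gt0.
have two_powR : (2 ^ k.+1)%:R <= v n `^ (e - s).
  by near: n; apply: large_powR; rewrite subr_gt0.
rewrite -opprB powRN div1r lef_pV2 ?posrE//.
exact: lt_le_trans two_powR.
Unshelve. all: by end_near. Qed.

Lemma geometric_half_nneseries_lty {R : realType} (u : nat -> R) :
  (forall k, 0 <= u k) -> (forall k, u k <= 1 / (2 ^ k.+1)%:R) ->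
  (\sum_(k <oo) (u k)%:E < +oo)%E.
Proof.
move=> u_ge0 u_le; apply: (@le_lt_trans _ _ 1%E); last exact: ltry.
apply: le_trans (epsilon_trick0 xpredT ler01).
by apply: lee_nneseries => k *; rewrite lee_fin.
Qed.

Lemma exists_sparse_subsequence {R : realType} (v : nat -> R)
    (s e t c1 c2 : R) :
  v @ \oo --> +oo -> s < e -> e < t -> 0 < c1 ->
  exists f : nat -> nat,
    [/\ (\sum_(k <oo) (v (f k) `^ (s - e))%:E < +oo)%E,
        forall A, exists k, A <= v (f k) `^ (t - e) &
        forall i k, (i < k)%N -> c2 * v (f i) < c1 * v (f k)].
Proof.
move=> voo se et c1_gt0.
have near_sep i : \forall n \near \oo, c2 * v i < c1 * v n.
  move/cvgryPgt : voo => /(_ (c2 * v i / c1)); apply: filterS => n.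
  by rewrite ltr_pdivrMr// [_ * c1]mulrC.
have [f [f_powR f_sep]] :=
  subsequence_near (fun k => near_powR_bounds k voo se et) near_sep.
exists f; split=> // [|A].
- apply: geometric_half_nneseries_lty => k; first exact: powR_ge0.
  by have [] := f_powR k.
- exists (Num.bound `|A|); have [_] := f_powR (Num.bound `|A|).
  by apply: le_trans; rewrite (le_trans (ler_norm A))// ltW// archi_boundP.
Qed.

Lemma trivIset_separated {d : Order.disp_t} {Y : porderType d} {T : Type}
    (F : nat -> set T) (g : T -> Y) (lower upper : nat -> Y) :
  (forall j x, F j x -> (lower j <= g x)%O /\ (g x <= upper j)%O) ->
  (forall i j, (i < j)%N -> (upper i < lower j)%O) -> trivIset [set: nat] F.
Proof.
move=> F_bounds sep.
have lt_disj i j x : (i < j)%N -> F i x -> ~ F j x.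
  move=> ij /F_bounds[_ g_le] /F_bounds[le_g _].
  by have := lt_geF (sep i j ij); rewrite (le_trans le_g).
move=> i j _ _ [x [xi xj]]; case: (ltngtP i j) => // ij.
- by have := lt_disj i j x ij xi xj.
- by have := lt_disj j i x ij xj xi.
Qed.

Lemma fsbig_only1 (R : Type) (idx : R) (op : Monoid.com_law idx)
    (I : choiceType) (F : I -> R) (i : I) :
  (forall j, j != i -> F j = idx) -> \big[op/idx]_(j \in [set: I]) F j = F i.
Proof.
move=> F0; rewrite -(fsbig_widen [set i]) ?fsbig_set1// => j [_ /eqP ji].
exact: F0.
Qed.

Lemma fsbig_ordT (R : Type) (idx : R) (op : Monoid.com_law idx) (n : nat)
    (F : nat -> R) :
  (forall j, (n <= j)%N -> F j = idx) ->
  \big[op/idx]_(j < n) F j = \big[op/idx]_(j \in [set: nat]) F j.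
Proof.
move=> F0; rewrite fsbig_ord; apply: fsbig_widen => // j [_ /negP].
by rewrite -leqNgt => /F0.
Qed.

Section IteratedIntegral.
Context {R : realType}.
Local Notation mu := (@lebesgue_measure R).
Local Open Scope ereal_scope.

(* The integral of a nonnegative function is by definition a supremum over the
   simple functions below it, measurable or not. *)
Lemma ge0_le_integral_nonmeas {d : measure_display} {T : measurableType d}
    (nu : {measure set T -> \bar R}) (f g : T -> \bar R) :
  (forall x, 0 <= f x) -> (forall x, f x <= g x) ->
  \int[nu]_x f x <= \int[nu]_x g x.
Proof.
move=> f0 fg; have g0 x : 0 <= g x := le_trans (f0 x) (fg x).
rewrite !ge0_integralTE//; apply: ereal_sup_le => _ [h /= hf <-].
by exists h => //= x; exact: le_trans (hf x) (fg x).
Qed.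

Lemma intRN_ge0 n (g : 'rV[R]_n -> \bar R) :
  (forall x, 0 <= g x) -> 0 <= intRN g.
Proof.
elim: n g => [|n IHn] g g0 //=.
by apply: integral_ge0 => t _; exact: IHn.
Qed.

Lemma le_intRN n (f g : 'rV[R]_n -> \bar R) :
  (forall x, 0 <= f x) -> (forall x, f x <= g x) -> intRN f <= intRN g.
Proof.
elim: n f g => [|n IHn] f g f0 fg //=.
by apply: ge0_le_integral_nonmeas => t; [exact: intRN_ge0 | exact: IHn].
Qed.

Definition box n (I : 'I_n -> set R) : set 'rV[R]_n :=
  [set x | forall i, I i (x ord0 i)].

Lemma indic_box_row_mx n (I : 'I_n.+1 -> set R) (t : R) (y : 'rV[R]_n) :
  \1_(box I) (row_mx (\row_(j < 1) t) y) =
  (\1_(I ord0) t * \1_(box (fun i => I (lift ord0 i))) y)%R :> R.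
Proof.
set x := row_mx _ _; rewrite !indicE -natrM mulnb; congr (nat_of_bool _)%:R.
have x0E : x ord0 ord0 = t.
  transitivity (x ord0 (lshift n ord0)); last by rewrite row_mxEl mxE.
  by congr (x _ _); exact/val_inj.
have xSE i : x ord0 (lift ord0 i) = y ord0 i.
  transitivity (x ord0 (rshift 1 i)); last by rewrite row_mxEr.
  by congr (x _ _); exact/val_inj.
apply/idP/andP => [/set_mem xI|[/set_mem tI /set_mem yI]]; rewrite !inE.
  by split=> [|i]; rewrite -?x0E -?xSE; exact: xI.
by move=> i; case: (unliftP ord0 i) => [k|] ->; rewrite ?xSE ?x0E//; exact: yI.
Qed.

Lemma intRN_nneseries_box n (e : nat -> \bar R) (I : nat -> 'I_n -> set R) :
  (forall j, 0 <= e j) -> (forall j i, measurable (I j i)) ->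
  intRN (fun x => \sum_(j <oo) e j * (\1_(box (I j)) x)%:E) =
  \sum_(j <oo) e j * \prod_(i < n) mu (I j i).
Proof.
elim: n e I => [|n IHn] e I e0 mI /=.
  apply: eq_eseriesr => j _; rewrite big_ord0 indicE mem_set//.
  by move=> -[].
have vol_ge0 j : 0 <= \prod_(i < n) mu (I j (lift ord0 i)).
  by apply: prode_ge0 => i _; exact: measure_ge0.
transitivity (\int[mu]_t \sum_(j <oo) (e j *
    \prod_(i < n) mu (I j (lift ord0 i))) * (\1_(I j ord0) t)%:E).
  apply: eq_integral => t _.
  transitivity (intRN (fun y => \sum_(j <oo) e j * (\1_(I j ord0) t)%:E *
      (\1_(box (fun i => I j (lift ord0 i))) y)%:E)).
    congr intRN; apply/funext => y; apply: eq_eseriesr => j _.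
    by rewrite indic_box_row_mx EFinM muleA.
  rewrite IHn// => [|j]; last by rewrite mule_ge0.
  by apply: eq_eseriesr => j _; rewrite muleAC.
have mindic j : measurable_fun [set: R] (EFin \o (\1_(I j ord0) : R -> R)).
  by apply/measurable_EFinP; exact: measurable_indic.
rewrite integral_nneseries//.
- apply: eq_eseriesr => j _.
  rewrite ge0_integralZl ?mule_ge0//; last exact: mindic.
  rewrite integral_indic; [|exact: measurableT|exact: mI].
  by rewrite setIT big_ord_recl [RHS]muleA muleAC.
- by move=> j; apply: measurable_funeM; exact: mindic.
- by move=> j t _; rewrite !mule_ge0.
Qed.

Lemma intRN_box n (e : \bar R) (I : 'I_n -> set R) :
  0 <= e -> (forall i, measurable (I i)) ->
  intRN (fun x => e * (\1_(box I) x)%:E) = e * \prod_(i < n) mu (I i).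
Proof.
move=> e0 mI; pose e_ j := if j is 0%N then e else 0.
have e_ge0 j : 0 <= e_ j by case: j.
have sum_e (p : nat -> \bar R) :
    (forall j, 0 <= p j) -> \sum_(j <oo) e_ j * p j = e * p 0%N.
  move=> p0; rewrite nneseries_recl// => [|j _]; last exact: mule_ge0.
  by rewrite eseries0 ?adde0// => -[|j]//= _ _; rewrite mul0e.
rewrite -(sum_e (fun=> \prod_(i < n) mu (I i))) => [|_]; last first.
  by apply: prode_ge0 => i _; exact: measure_ge0.
rewrite -intRN_nneseries_box//.
by congr intRN; apply/funext => x; rewrite (sum_e (fun=> (\1_(box I) x)%:E)).
Qed.

Lemma ballE_box n (c : 'rV[R]_n) (w : R) : (0 < w)%R ->
  ball c w = box (fun i => ball (c ord0 i) w).
Proof.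
move=> w0; apply/seteqP; split=> [x [_ xc] i|x xc]; first exact: xc.
by split=> // i j; rewrite ord1.
Qed.

Lemma intRN_le_nneseries_ball n (g : 'rV[R]_n -> R) (e w : nat -> R)
    (c : nat -> 'rV[R]_n) :
  (forall j, 0 <= e j)%R -> (forall j, 0 < w j)%R -> (forall x, 0 <= g x)%R ->
  (forall x, g x = 0%R \/ exists2 j, ball (c j) (w j) x & (g x <= e j)%R) ->
  intRN (fun x => (g x)%:E) <= \sum_(j <oo) (e j * (w j *+ 2) ^+ n)%:E.
Proof.
move=> e0 w0 g0 ge.
have sum_ge0 x : 0 <= \sum_(j <oo) (e j)%:E * (\1_(ball (c j) (w j)) x)%:E.
  by apply: nneseries_ge0 => j _ _; rewrite -EFinM lee_fin mulr_ge0.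
apply: (@le_trans _ _ (intRN (fun x : 'rV[R]_n =>
    \sum_(j <oo) (e j)%:E * (\1_(ball (c j) (w j)) x)%:E))).
  apply: le_intRN => x; first by rewrite lee_fin.
  have [->//|[j xj gxe]] := ge x.
  rewrite (@nneseriesD1 _ _ j)// => [|i _]; last first.
    by rewrite -EFinM lee_fin mulr_ge0.
  rewrite indicE mem_set// mule1 (le_trans _ (leeDl _ _)) ?lee_fin//.
  by apply: nneseries_ge0 => i _ _; rewrite -EFinM lee_fin mulr_ge0.
under eq_fun do under eq_eseriesr do rewrite ballE_box//.
rewrite intRN_nneseries_box//; last by move=> j i; exact: measurable_ball.
apply: lee_nneseries => [j _ _|j _].
  by rewrite mule_ge0// ?lee_fin// prode_ge0.
under eq_bigr do rewrite lebesgue_measure_ball ?ltW//.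
by rewrite prodEFin prodr_const card_ord EFinM.
Qed.

Lemma intRN_ge_ball n (g : 'rV[R]_n -> R) (e w : R) (c : 'rV[R]_n) :
  (0 <= e)%R -> (0 < w)%R -> (forall x, 0 <= g x)%R ->
  (forall x, ball c w x -> e <= g x)%R ->
  (e * (w *+ 2) ^+ n)%:E <= intRN (fun x => (g x)%:E).
Proof.
move=> e0 w0 g0 ge.
apply: (@le_trans _ _ (intRN (fun x => e%:E * (\1_(ball c w) x)%:E))).
  rewrite ballE_box// intRN_box//; last by move=> i; exact: measurable_ball.
  under eq_bigr do rewrite lebesgue_measure_ball ?ltW//.
  by rewrite prodEFin prodr_const card_ord EFinM.
apply: le_intRN => x; rewrite -EFinM lee_fin ?mulr_ge0// indicE.
have [xc|xc] := pselect (ball c w x); first by rewrite mem_set// mulr1 ge.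
by rewrite memNset// mulr0.
Qed.

End IteratedIntegral.

Section RealDerivative.
Context {R : realType}.

Lemma is_derive0_le_sqr (f : R -> R) (C : R) :
  (forall x, `|f x| <= C * x ^+ 2) -> is_derive (0 : R) (1 : R) f 0.
Proof.
move=> fC; have f0 : f 0 = 0.
  apply/normr0_eq0/le_anti.
  by rewrite normr_ge0 (le_trans (fC 0))// expr0n mulr0.
have C1 : 0 < `|C| + 1 by rewrite ltr_wpDl.
have quotient_cvg0 : h^-1 *: ((f \o shift 0) (h *: (1 : R)) - f 0)
    @[h --> 0^'] --> (0 : R).
  apply/cvgrPdist_le => eps eps0; near=> h.
  have h_neq0 : h != 0 by near: h; exact: nbhs_dnbhs_neq.
  rewrite sub0r normrN f0 /= addr0 subr0 [_ *: 1]mulr1 [_ *: _]mulrC.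
  rewrite normrM normfV ler_pdivrMr ?normr_gt0// (le_trans (fC h))//.
  rewrite -real_normK ?num_real// expr2 mulrA ler_wpM2r//.
  rewrite (@le_trans _ _ ((`|C| + 1) * `|h|))//.
    by rewrite ler_wpM2r// (le_trans (ler_norm C))// lerDl.
  rewrite mulrC -ler_pdivlMr//; near: h.
  by apply: dnbhs0_le; rewrite divr_gt0.
by split; [apply/cvg_ex; exists 0 | exact/cvg_lim].
Unshelve. all: by end_near. Qed.

Definition smooth1 (g : R -> R) : Prop :=
  forall k x, derivable (derive1n k g) x 1.

Lemma smooth1_derive1 (g : R -> R) : smooth1 g -> smooth1 (derive1 g).
Proof. by move=> sg k x; rewrite -derive1Sn; exact: sg. Qed.

Lemma smooth1_continuous (g : R -> R) : smooth1 g -> continuous g.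
Proof.
by move=> sg x; apply/differentiable_continuous/derivable1_diffP/(sg 0%N).
Qed.

End RealDerivative.

Section DirectionalDerivative.
Context {R : realType} {V : normedModType R}.
Implicit Types (f : V -> R) (x v : V).

Lemma is_derive_lineP f x v (d : R) :
  is_derive x v f d <->
  is_derive (0 : R) (1 : R) (fun h : R => f (h *: v + x)) d.
Proof.
pose F (h : R) := f (h *: v + x).
have quotientE : (fun h : R => h^-1 *: ((F \o shift 0) (h *: (1 : R)) - F 0)) =
    (fun h : R => h^-1 *: ((f \o shift x) (h *: v) - f x)).
  apply/funext => h; rewrite /F /= addr0 scale0r add0r.
  by rewrite [_ *: (1 : R)]mulr1.
by split=> -[df dE]; split; move: df dE; rewrite /derivable /derive quotientE.
Qed.

Lemma is_derive_comp f (g : R -> R) x v (df dg : R) :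
  is_derive x v f df -> is_derive (f x) (1 : R) g dg ->
  is_derive x v (g \o f) (dg * df).
Proof.
move=> /is_derive_lineP df_line dgf; apply/is_derive_lineP.
apply: (@is_derive1_comp _ g (fun h => f (h *: v + x))) => //.
by rewrite scale0r add0r.
Qed.

End DirectionalDerivative.

Section FlatFunction.
Context {R : realType}.
Implicit Types (p : {poly R}) (x : R).

(* The derivatives of exp (- 1/x), extended by 0 to x <= 0, all have this
   form, which is why the polynomial is carried along. *)
Definition flat p x : R := if 0 < x then p.[x^-1] * expR (- x^-1) else 0.

Lemma flat_gt0E p x : 0 < x -> flat p x = p.[x^-1] * expR (- x^-1).
Proof. by rewrite /flat => ->. Qed.

Lemma flat_le0E p x : x <= 0 -> flat p x = 0.
Proof. by rewrite /flat ltNge => ->. Qed.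

Lemma exprn_expRN_le_fact n (y : R) : 0 <= y -> y ^+ n * expR (- y) <= n`!%:R.
Proof.
move=> y0; rewrite expRN ler_pdivrMr ?expR_gt0//.
case: n => [|n]; first by rewrite expr0 mul1r -expR0 ler_expR.
rewrite mulrC -ler_pdivrMr ?ltr0n ?fact_gt0//.
by rewrite (le_trans _ (expR_ge1Dxn n y0))// lerDr.
Qed.

Lemma flat_bounded p : exists2 C : R, 0 <= C & forall x, `|flat p x| <= C.
Proof.
have coef_fact_ge0 i : 0 <= `|p`_i| * i`!%:R :> R by rewrite mulr_ge0.
exists (\sum_(i < size p) `|p`_i| * i`!%:R) => [|x]; first exact: sumr_ge0.
have [x_gt0|x_le0] := ltP 0 x; last by rewrite flat_le0E// normr0 sumr_ge0.
rewrite flat_gt0E// horner_coef mulr_suml (le_trans (ler_norm_sum _ _ _))//.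
apply: ler_sum => i _; rewrite -mulrA normrM ler_wpM2l//.
have invx_ge0 : 0 <= x^-1 by rewrite invr_ge0 ltW.
by rewrite ger0_norm ?exprn_expRN_le_fact// mulr_ge0 ?exprn_ge0 ?expR_ge0.
Qed.

Lemma flatMX2 p x : flat p x = x ^+ 2 * flat ('X^2 * p) x.
Proof.
have [x_gt0|x_le0] := ltP 0 x; last by rewrite !flat_le0E// mulr0.
by rewrite !flat_gt0E// hornerM hornerXn; field; rewrite gt_eqF.
Qed.

Definition dflat p : {poly R} := 'X^2 * (p - p^`()).

Lemma is_derive_flat_gt0 p x : 0 < x ->
  is_derive x (1 : R) (flat p) (flat (dflat p) x).
Proof.
move=> x_gt0; have x_neq0 : x != 0 by rewrite gt_eqF.
apply: (near_eq_is_derive (f := fun y : R => p.[y^-1] * expR (- y^-1))).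
  by near=> y; rewrite flat_gt0E//; near: y; exact: lt_nbhsr.
have dinv : is_derive x (1 : R) (fun y : R => y^-1) (- x ^- 2).
  have := @is_deriveV _ id x 1 1 x_neq0 (is_derive_id _ _).
  by rewrite /GRing.scale/= mulr1.
have dhorner := is_derive1_comp (is_derive_poly p x^-1) dinv.
have dexp := @is_derive1_comp _ expR (fun y : R => - y^-1) x _ _
  (is_derive_expR _) (is_deriveN dinv).
apply: is_derive_eq (is_deriveM dhorner dexp) _.
by rewrite flat_gt0E// !hornerE /GRing.scale/= exprVn; ring.
Unshelve. all: by end_near. Qed.

Lemma is_derive_flat p x : is_derive x (1 : R) (flat p) (flat (dflat p) x).
Proof.
have [x_gt0|x_lt0|<-] := ltgtP 0 x; first exact: is_derive_flat_gt0.
- apply: (near_eq_is_derive (f := cst 0)).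
    by near=> y; rewrite flat_le0E//; apply/ltW; near: y; exact: lt_nbhsl.
  by rewrite flat_le0E ?ltW//; exact: is_derive_cst.
- rewrite flat_le0E//; have [C _ flatC] := flat_bounded ('X^2 * p).
  apply: (@is_derive0_le_sqr _ _ C) => y.
  by rewrite flatMX2 normrM mulrC (ger0_norm (sqr_ge0 y)) ler_wpM2r ?sqr_ge0.
Unshelve. all: by end_near. Qed.

Lemma smooth1_flat p : smooth1 (flat p).
Proof.
have derive1n_flat k : derive1n k (flat p) = flat (iter k dflat p).
  elim: k => [//|k IHk]; rewrite derive1nS IHk; apply/funext => x.
  by rewrite derive1E; have [_ ->] := is_derive_flat (iter k dflat p) x.
move=> k x; rewrite derive1n_flat.
by have [] := is_derive_flat (iter k dflat p) x.
Qed.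

Lemma flat1_gt0 x : 0 < x -> 0 < flat 1 x.
Proof. by move=> x_gt0; rewrite flat_gt0E// hornerC mul1r expR_gt0. Qed.

Lemma flat1_ge0 x : 0 <= flat 1 x.
Proof.
by have [/flat1_gt0/ltW|x_le0] := ltP 0 x; last by rewrite flat_le0E.
Qed.

Lemma flat1_le1 x : flat 1 x <= 1.
Proof.
have [x_gt0|x_le0] := ltP 0 x; last by rewrite flat_le0E.
rewrite flat_gt0E// hornerC mul1r -expR0 ler_expR oppr_le0.
by rewrite invr_ge0 ltW.
Qed.

Lemma flat1_nondecreasing : {homo flat 1 : x y / x <= y}.
Proof.
move=> x y xy; have [x0|x0] := leP x 0; first by rewrite flat_le0E// flat1_ge0.
have y0 := lt_le_trans x0 xy.
by rewrite !flat_gt0E// !hornerC !mul1r ler_expR lerN2 lef_pV2.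
Qed.

End FlatFunction.

Section Smoothness.
Context {R : realType} {N : nat}.
Implicit Types (f g : 'rV[R]_N -> R) (x : 'rV[R]_N) (i j : 'I_N) (k : nat).

Lemma CkW k f : Ck k.+1 f -> Ck k f.
Proof.
elim: k f => [|k IHk] f [cf df]; first exact: cf.
by split=> // i; have [dfi Cdfi] := df i; split=> //; exact: IHk.
Qed.

Lemma Ck_cst k (a : R) : @Ck R N k (cst a).
Proof.
elim: k a => [|k IHk] a; first exact: cst_continuous.
split=> [|i]; first exact: cst_continuous.
split=> [x|]; first by have [] := is_derive_cst a x (ebase R i).
by under eq_fun do rewrite derive_cst; exact: IHk.
Qed.

Lemma CkD k f g : Ck k f -> Ck k g -> Ck k (f \+ g).
Proof.
elim: k f g => [|k IHk] f g; first by move=> cf cg x; exact: cvgD (cf x) (cg x).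
move=> [cf df] [cg dg]; split=> [x|i]; first exact: cvgD (cf x) (cg x).
have [dfi Cdfi] := df i; have [dgi Cdgi] := dg i.
split=> [x|]; first exact: derivableD (dfi x) (dgi x).
under eq_fun do rewrite (deriveD (dfi _) (dgi _)).
exact: IHk.
Qed.

Lemma CkM k f g : Ck k f -> Ck k g -> Ck k (f \* g).
Proof.
elim: k f g => [|k IHk] f g; first by move=> cf cg x; exact: cvgM (cf x) (cg x).
move=> Cf Cg; have [cf df] := Cf; have [cg dg] := Cg.
split=> [x|i]; first exact: cvgM (cf x) (cg x).
have [dfi Cdfi] := df i; have [dgi Cdgi] := dg i.
split=> [x|]; first exact: derivableM (dfi x) (dgi x).
under eq_fun do rewrite (deriveM (dfi _) (dgi _)).
by apply: CkD; apply: IHk => //; exact: CkW.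
Qed.

Lemma Ck_sum k (I : Type) (s : seq I) (F : I -> 'rV[R]_N -> R) :
  (forall e, Ck k (F e)) -> Ck k (fun x => \sum_(e <- s) F e x).
Proof.
move=> CF; elim: s => [|e s IHs].
  by under eq_fun do rewrite big_nil; exact: Ck_cst.
by under eq_fun do rewrite big_cons; exact: CkD.
Qed.

Lemma Ck_comp k (g : R -> R) f : smooth1 g -> Ck k f -> Ck k (g \o f).
Proof.
elim: k g f => [|k IHk] g f sg Cf.
  by move=> x; apply: continuous_comp; [exact: Cf|exact: smooth1_continuous].
have [cf df] := Cf; split=> [x|i].
  by apply: continuous_comp; [exact: cf|exact: smooth1_continuous].
have [dfi Cdfi] := df i.
have dgf x : is_derive x (ebase R i) (g \o f)
    (derive1 g (f x) * 'D_(ebase R i) f x).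
  apply: is_derive_comp; first exact/derivableP.
  by rewrite derive1E; exact/derivableP/(sg 0%N).
split=> [x|]; first by have [] := dgf x.
under eq_fun do rewrite (@derive_val _ _ _ _ _ _ _ (dgf _)).
by apply: CkM => //; apply: IHk; [exact: smooth1_derive1 | exact: CkW].
Qed.

Lemma is_derive_coord x i j :
  is_derive x (ebase R j) (fun y : 'rV[R]_N => y ord0 i) (i == j)%:R.
Proof.
apply/is_derive_lineP.
rewrite (_ : (fun _ => _) =
    (fun h : R => (i == j)%:R * h + x ord0 i)); last first.
  by apply/funext => h; rewrite !mxE eqxx mulrC.
have := is_deriveD (is_deriveZ (i == j)%:R (is_derive_id (0 : R) 1))
  (is_derive_cst (x ord0 i) (0 : R) 1).
by rewrite addr0 [_ *: 1]mulr1.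
Qed.

Lemma Ck_coord k i : Ck k (fun x : 'rV[R]_N => x ord0 i).
Proof.
have ccoord : continuous (fun x : 'rV[R]_N => x ord0 i).
  exact: coord_continuous.
case: k => [//|k]; split=> // j.
split=> [x|]; first by have [] := is_derive_coord x i j.
under eq_fun do rewrite (@derive_val _ _ _ _ _ _ _ (is_derive_coord _ i j)).
exact: Ck_cst.
Qed.

Lemma Cc_infZ (a : R) f : Cc_inf f -> Cc_inf (a \*: f).
Proof.
move=> [sf [r fr]]; split=> [k|]; first by apply: CkM => //; exact: Ck_cst.
by exists r => x /fr fx; rewrite /= fx scaler0.
Qed.

Lemma Cc_inf_sum (n : nat) (F : nat -> 'rV[R]_N -> R) :
  (forall m, Cc_inf (F m)) -> Cc_inf (fun x => \sum_(m < n) F m x).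
Proof.
move=> CF; split=> [k|]; first by apply: Ck_sum => m; have [] := CF m.
have /choice[r Fr] m := (CF m).2.
exists (\big[Num.max/0]_(m < n) r m) => x xr; rewrite big1// => m _; apply: Fr.
by rewrite (le_lt_trans _ xr)// (le_bigmax _ (fun m : 'I_n => r m)).
Qed.

End Smoothness.

Section EuclideanNorm.
Context {R : realType} {N : nat}.
Implicit Types (x c : 'rV[R]_N) (i : 'I_N) (r : R).

Lemma eucl_norm_ge0 x : 0 <= eucl_norm x.
Proof. exact: sqrtr_ge0. Qed.

Lemma eucl_norm_sqr x : eucl_norm x ^+ 2 = \sum_(i < N) x ord0 i ^+ 2.
Proof. by rewrite sqr_sqrtr// sumr_ge0// => i _; exact: sqr_ge0. Qed.

Lemma coord_le_norm x i : `|x ord0 i| <= `|x|.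
Proof.
rewrite [leRHS]/Num.Def.normr/= mx_normrE.
exact: (le_bigmax _ (fun ij : 'I_1 * 'I_N => `|x ij.1 ij.2|) (ord0, i)).
Qed.

Lemma norm_le_eucl_norm x : `|x| <= eucl_norm x.
Proof.
rewrite [leLHS]/Num.Def.normr/= mx_normrE.
apply: bigmax_le => [|[i j] _ /=]; first exact: eucl_norm_ge0.
rewrite -ler_sqr ?nnegrE ?eucl_norm_ge0// real_normK ?num_real// eucl_norm_sqr.
by rewrite ord1 (bigD1 j)//= lerDl sumr_ge0// => k _; exact: sqr_ge0.
Qed.

Lemma eucl_norm_le_norm x : eucl_norm x <= Num.sqrt N%:R * `|x|.
Proof.
rewrite -ler_sqr ?nnegrE ?eucl_norm_ge0 ?mulr_ge0 ?sqrtr_ge0//.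
rewrite eucl_norm_sqr exprMn sqr_sqrtr// mulr_natl -[X in _ *+ X]card_ord.
rewrite -sumr_const; apply: ler_sum => i _.
by rewrite -real_normK ?num_real// ler_sqr ?nnegrE// coord_le_norm.
Qed.

Lemma is_derive_eucl_norm_sqr c x i :
  is_derive x (ebase R i) (fun y => eucl_norm (y - c) ^+ 2)
    (2 * (x ord0 i - c ord0 i)).
Proof.
pose sqr_coord j := fun y : 'rV[R]_N => (y ord0 j - c ord0 j) ^+ 2.
have dsqr_coord j : is_derive x (ebase R i) (sqr_coord j)
    ((i == j)%:R * (2 * (x ord0 j - c ord0 j))).
  have dcoord :
      is_derive x (ebase R i) (fun y => y ord0 j - c ord0 j) (i == j)%:R.
    rewrite eq_sym -[(_ == _)%:R]subr0.
    exact: is_deriveB (is_derive_coord x j i) (is_derive_cst _ _ _).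
  rewrite /sqr_coord; under eq_fun do rewrite expr2.
  apply: is_derive_eq (is_deriveM dcoord dcoord) _.
  by rewrite /GRing.scale/=; ring.
rewrite (_ : (fun _ => _) = \sum_(j < N) sqr_coord j).
  apply: is_derive_eq (is_derive_sum dsqr_coord) _.
  rewrite (bigD1 i)//= eqxx mul1r big1 ?addr0// => j /negPf ji.
  by rewrite eq_sym ji mul0r.
apply/funext => y; rewrite eucl_norm_sqr fct_sumE.
by apply: eq_bigr => j _; rewrite !mxE.
Qed.

Lemma Ck_eucl_norm_sqr k c : Ck k (fun x => eucl_norm (x - c) ^+ 2).
Proof.
under eq_fun do rewrite eucl_norm_sqr.
apply: Ck_sum => i; under eq_fun do rewrite !mxE expr2.
have Ccoord : Ck k (fun x : 'rV[R]_N => x ord0 i - c ord0 i).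
  exact: CkD (Ck_coord k i) (Ck_cst k (- c ord0 i)).
exact: CkM.
Qed.

Definition eball c r : set 'rV[R]_N := [set x | eucl_norm (x - c) < r].

Lemma eball_center c r : 0 < r -> eball c r c.
Proof.
move=> r0; rewrite /eball /eucl_norm /= subrr big1 ?sqrtr0// => i _.
by rewrite mxE expr0n.
Qed.

Lemma sub_eball_ball c r : eball c r `<=` ball c r.
Proof.
move=> x xc; rewrite -ball_normE /ball_/= -normrN opprB.
exact: le_lt_trans (norm_le_eucl_norm _) xc.
Qed.

Lemma eucl_norm_le_ball c r x :
  ball c r x -> eucl_norm (x - c) <= Num.sqrt N%:R * r.
Proof.
rewrite -ball_normE /ball_/= distrC => /ltW xc.
by rewrite (le_trans (eucl_norm_le_norm _))// ler_wpM2l// sqrtr_ge0.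
Qed.

End EuclideanNorm.

Section Bump.
Context {R : realType} {N : nat}.
Implicit Types (x c : 'rV[R]_N) (i : 'I_N) (r : R).

Definition bump c r x : R := flat 1 (1 - (eucl_norm (x - c) / r) ^+ 2).

Lemma bump_ge0 c r x : 0 <= bump c r x.
Proof. exact: flat1_ge0. Qed.

Lemma bump_le1 c r x : bump c r x <= 1.
Proof. exact: flat1_le1. Qed.

Lemma bump_ge_half_radius c r x : 0 < r -> eucl_norm (x - c) <= r / 2 ->
  flat 1 (3 / 4) <= bump c r x.
Proof.
move=> r0 xc; apply: flat1_nondecreasing.
have : (eucl_norm (x - c) / r) ^+ 2 <= (2^-1) ^+ 2.
  rewrite ler_sqr ?nnegrE ?divr_ge0 ?eucl_norm_ge0 ?(ltW r0)//.
  by rewrite ler_pdivrMr// mulrC.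
by rewrite expr2 expr2; lra.
Qed.

Lemma bump_arg_le0 c r x : 0 < r ->
  ~ eball c r x -> 1 - (eucl_norm (x - c) / r) ^+ 2 <= 0.
Proof.
move=> r0 /negP; rewrite -leNgt => xc.
by rewrite subr_le0 exprn_ege1// ler_pdivlMr// mul1r.
Qed.

Lemma bump_out c r x : 0 < r -> ~ eball c r x -> bump c r x = 0.
Proof. by move=> r0 xc; rewrite /bump flat_le0E// bump_arg_le0. Qed.

Definition dbump c r i x : R :=
  - (2 / r ^+ 2 * (x ord0 i - c ord0 i)) *
  flat (dflat 1) (1 - (eucl_norm (x - c) / r) ^+ 2).

Lemma bumpE c r :
  bump c r = flat 1 \o (fun x => 1 - r ^- 2 * eucl_norm (x - c) ^+ 2).
Proof.
by apply/funext => x; rewrite /bump /= expr_div_n [_ * _ ^-1]mulrC.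
Qed.

Lemma is_derive_bump c r x i :
  is_derive x (ebase R i) (bump c r) (dbump c r i x).
Proof.
have dinner : is_derive x (ebase R i)
    (fun y => 1 - r ^- 2 * eucl_norm (y - c) ^+ 2)
    (- (2 / r ^+ 2 * (x ord0 i - c ord0 i))).
  have := is_deriveB (is_derive_cst (1 : R) x (ebase R i))
    (is_deriveZ (r ^- 2) (is_derive_eucl_norm_sqr c x i)).
  by move=> /is_derive_eq; apply; rewrite sub0r [_ *: _]mulrA [_ / _]mulrC.
rewrite bumpE; apply: is_derive_eq.
  exact: is_derive_comp dinner (is_derive_flat 1 _).
by rewrite mulrC /dbump expr_div_n [_ ^-2 * _]mulrC.
Qed.

Lemma dbump_out c r x i : 0 < r -> ~ eball c r x -> dbump c r i x = 0.
Proof.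
by move=> r0 xc; rewrite /dbump flat_le0E ?mulr0// bump_arg_le0.
Qed.

Lemma sum_dbump_sqr_le : exists2 D : R, 0 <= D & forall c r x, 0 < r ->
  \sum_(i < N) dbump c r i x ^+ 2 <= D / r ^+ 2.
Proof.
have [C C0 flatC] := flat_bounded (dflat (1 : {poly R})).
exists (4 * C ^+ 2) => [|c r x r0]; first by rewrite mulr_ge0 ?sqr_ge0.
have bound_ge0 : 0 <= 4 * C ^+ 2 / r ^+ 2.
  by apply: divr_ge0; rewrite ?sqr_ge0// mulr_ge0 ?sqr_ge0.
have [xc|xc] := pselect (eball c r x); last first.
  by rewrite big1// => i _; rewrite dbump_out// expr0n.
set F := flat (dflat 1) (1 - (eucl_norm (x - c) / r) ^+ 2).
rewrite (_ : \sum_(i < N) _ =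
    4 * F ^+ 2 / r ^+ 2 * (eucl_norm (x - c) / r) ^+ 2); last first.
  rewrite expr_div_n eucl_norm_sqr mulr_suml mulr_sumr.
  apply: eq_bigr => i _; rewrite /dbump !mxE -/F.
  by field; rewrite gt_eqF.
rewrite -[leRHS]mulr1; apply: ler_pM; rewrite ?sqr_ge0//.
- by apply: divr_ge0; rewrite ?sqr_ge0// mulr_ge0 ?sqr_ge0.
- rewrite ler_wpM2r ?invr_ge0 ?sqr_ge0// ler_wpM2l//.
  by rewrite -[leLHS]real_normK ?num_real// ler_sqr ?nnegrE// flatC.
- rewrite expr_le1// ?divr_ge0 ?eucl_norm_ge0 ?(ltW r0)//.
  by rewrite ler_pdivrMr// mul1r ltW.
Qed.

Lemma Cc_inf_bump c r : 0 < r -> Cc_inf (bump c r).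
Proof.
move=> r0; split=> [k|].
  rewrite bumpE; apply: Ck_comp; first exact: smooth1_flat.
  have -> : (fun x => 1 - r ^- 2 * eucl_norm (x - c) ^+ 2) =
      cst 1 \+ (cst (- r ^- 2) \* (fun x => eucl_norm (x - c) ^+ 2)).
    by apply/funext => x; rewrite /= mulNr.
  apply: CkD; first exact: Ck_cst.
  by apply: CkM; [exact: Ck_cst | exact: Ck_eucl_norm_sqr].
exists (Num.sqrt N%:R * (r + `|c|)) => x xr; apply: bump_out => // xc.
have : `|x| <= r + `|c|.
  rewrite -[x](subrK c) (le_trans (ler_normD _ _))// lerD2r.
  by rewrite ltW// (le_lt_trans (norm_le_eucl_norm _)).
move=> /(ler_wpM2l (sqrtr_ge0 N%:R)) /(le_trans (eucl_norm_le_norm x)).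
by rewrite leNgt xr.
Qed.

Lemma measurableRN_bump c r : measurableRN (bump c r).
Proof.
have cflat : continuous (flat (1 : {poly R})).
  by apply: smooth1_continuous; exact: smooth1_flat.
rewrite /measurableRN /bump.
apply: (@measurableT_comp _ _ _ _ _ _ (flat (1 : {poly R}))).
  exact: continuous_measurable_fun.
under eq_fun do rewrite expr_div_n eucl_norm_sqr.
apply: measurable_funB => //; apply: measurable_funM => //.
apply: measurable_sum => i; under eq_fun do rewrite !mxE.
by apply: measurable_funX; apply: measurable_funB => //; exact: measurable_tnth.
Qed.

End Bump.

Section Truncation.
Context {R : numDomainType}.
Implicit Types (a b : nat -> R) (k l n K : nat).

Definition vanishing_from n a : Prop := forall j, (n <= j)%N -> a j = 0.

Definition tail_dominated K a b : Prop :=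
  (forall j, (j < K)%N -> b j = 0) /\ (forall j, `|b j| <= `|a j|).

Definition truncate n a (j : nat) : R := if (j < n)%N then a j else 0.

Lemma vanishing_truncate n a : vanishing_from n (truncate n a).
Proof. by move=> j; rewrite /truncate ltnNge => ->. Qed.

Lemma vanishing_truncateB k l a :
  vanishing_from (maxn k l) (fun j => truncate k a j - truncate l a j).
Proof.
move=> j; rewrite geq_max => /andP[kj lj].
by rewrite !vanishing_truncate// subrr.
Qed.

Lemma tail_dominated_truncateB K k l a : (K <= k)%N -> (K <= l)%N ->
  tail_dominated K a (fun j => truncate k a j - truncate l a j).
Proof.
move=> Kk Kl; rewrite /truncate; split=> j.
  by move=> jK; rewrite !(leq_trans jK)// subrr.
by case: ifP; case: ifP; rewrite ?subrr ?subr0 ?sub0r ?normrN ?normr0.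
Qed.

Lemma tail_dominated_truncate_sub K k a : (K <= k)%N ->
  tail_dominated K a (fun j => truncate k a j - a j).
Proof.
move=> Kk; rewrite /truncate; split=> j.
  by move=> jK; rewrite (leq_trans jK)// subrr.
by case: ifP; rewrite ?subrr ?sub0r ?normrN ?normr0.
Qed.

End Truncation.

Section DisjointBumps.
Context {R : realType} {N : nat} (c : nat -> 'rV[R]_N) (r : nat -> R).
Implicit Types (a b : nat -> R) (x : 'rV[R]_N) (i : 'I_N) (j k n : nat).

(* [\sum_(j \in A)] is 0 by convention if infinitely many terms are nonzero;
   here at most one is, since the balls are assumed disjoint below. *)
Definition bump_sum a x : R := \sum_(j \in [set: nat]) a j * bump (c j) (r j) x.

Local Notation B j := (eball (c j) (r j)).

Hypothesis r_gt0 : forall j, 0 < r j.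
Hypothesis disjB : trivIset [set: nat] (fun j => B j).

Lemma eball_neq_out j k x : B j x -> k != j -> ~ B k x.
Proof. by move=> xj /eqP kj xk; apply: kj; apply: disjB => //; exists x. Qed.

Lemma bump_sum_in a j x : B j x -> bump_sum a x = a j * bump (c j) (r j) x.
Proof.
move=> xj; apply: fsbig_only1 => k kj.
by rewrite bump_out ?mulr0//; exact: eball_neq_out kj.
Qed.

Lemma bump_sum_out a x : (forall j, ~ B j x) -> bump_sum a x = 0.
Proof. by move=> xB; apply: fsbig1 => j _; rewrite bump_out ?mulr0. Qed.

Lemma bump_sumB a b :
  (fun x => bump_sum a x - bump_sum b x) = bump_sum (fun j => a j - b j).
Proof.
apply/funext => x; have [[j xj]|/forallNP xB] := pselect (exists j, B j x).
  by rewrite !(bump_sum_in _ xj) mulrBl.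
by rewrite !bump_sum_out// subr0.
Qed.

Lemma bump_sum_finiteE a n : vanishing_from n a ->
  bump_sum a = (fun x => \sum_(j < n) a j * bump (c j) (r j) x).
Proof.
move=> a0; apply/funext => x.
rewrite (@fsbig_ordT _ _ _ _ (fun j => a j * bump (c j) (r j) x))// => j nj.
by rewrite a0// mul0r.
Qed.

Lemma Cc_inf_bump_sum a n : vanishing_from n a -> Cc_inf (bump_sum a).
Proof.
move=> /bump_sum_finiteE->.
apply: (Cc_inf_sum n (F := fun j => a j \*: bump (c j) (r j))) => j.
by apply: Cc_infZ; exact: Cc_inf_bump.
Qed.

Lemma derive_bump_sum a n x i : vanishing_from n a ->
  'D_(ebase R i) (bump_sum a) x =
    \sum_(j \in [set: nat]) a j * dbump (c j) (r j) i x.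
Proof.
move=> a0; rewrite (bump_sum_finiteE a0).
rewrite -(@fsbig_ordT _ _ _ n) => [|j nj]; last by rewrite a0// mul0r.
rewrite (_ : (fun _ => _) = \sum_(j < n) (a j \*: bump (c j) (r j))).
  apply: (@derive_val _ _ _ _ _ _ _ (is_derive_sum _)) => j.
  exact: is_deriveZ (is_derive_bump (c j) (r j) x i).
by apply/funext => y; rewrite fct_sumE.
Qed.

Lemma grad_sq_bump_sum_in a n j x : vanishing_from n a -> B j x ->
  grad_sq (bump_sum a) x = a j ^+ 2 * \sum_(i < N) dbump (c j) (r j) i x ^+ 2.
Proof.
move=> a0 xj; rewrite /grad_sq mulr_sumr; apply: eq_bigr => i _.
rewrite (derive_bump_sum _ _ a0) -exprMn; congr (_ ^+ 2).
apply: (@fsbig_only1 _ _ _ _ (fun k => a k * dbump (c k) (r k) i x)) => k kj.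
by rewrite dbump_out ?mulr0//; exact: eball_neq_out kj.
Qed.

Lemma grad_sq_bump_sum_out a n x : vanishing_from n a ->
  (forall j, ~ B j x) -> grad_sq (bump_sum a) x = 0.
Proof.
move=> a0 xB; rewrite /grad_sq big1// => i _.
rewrite (derive_bump_sum _ _ a0) fsbig1 ?expr0n// => j _.
by rewrite dbump_out ?mulr0.
Qed.

Lemma measurableRN_bump_sum a : measurableRN (bump_sum a).
Proof.
apply: (@measurable_fun_cvg _ _ _ _
  (fun n (t : N.-tuple R) => bump_sum (truncate n a) (\row_i tnth t i))).
  move=> n; rewrite (bump_sum_finiteE (@vanishing_truncate _ n a)).
  apply: measurable_sum => j; apply: measurable_funM => //.
  exact: measurableRN_bump.
move=> t _; set x := \row_i _; apply: cvg_near_cst.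
have [[j xj]|/forallNP xB] := pselect (exists j, B j x); last first.
  by near=> n; rewrite !bump_sum_out.
near=> n; rewrite !(bump_sum_in _ xj) /truncate ifT//.
by near: n; exact: nbhs_infty_gt.
Unshelve. all: by end_near. Qed.

Section FiniteEnergy.
Variables (V : 'rV[R]_N -> R) (upper : nat -> R).
Hypothesis V_ge0 : forall x, 0 <= V x.
Hypothesis V_le : forall j x, B j x -> V x <= upper j.

Definition energy_term a j : R := a j ^+ 2 * (r j ^- 2 + upper j) * r j ^+ N.

Definition energy a : \bar R := (\sum_(j <oo) (energy_term a j)%:E)%E.

Let upper_ge0 j : 0 <= upper j.
Proof.
by apply: le_trans (V_ge0 (c j)) (V_le _); exact: eball_center.
Qed.

Let weight_ge0 j : 0 <= r j ^- 2 + upper j.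
Proof. by rewrite addr_ge0 ?upper_ge0// invr_ge0 sqr_ge0. Qed.

Lemma energy_term_ge0 a j : 0 <= energy_term a j.
Proof.
apply: mulr_ge0; last by rewrite exprn_ge0// ltW.
by rewrite mulr_ge0 ?sqr_ge0.
Qed.

Lemma intRN_le_energy (A : R) a (g : 'rV[R]_N -> R) :
  0 <= A -> (forall x, 0 <= g x) ->
  (forall j x, B j x -> g x <= A * (a j ^+ 2 * (r j ^- 2 + upper j))) ->
  (forall x, (forall j, ~ B j x) -> g x = 0) ->
  (intRN (fun x => (g x)%:E) <= (A * 2 ^+ N)%:E * energy a)%E.
Proof.
move=> A0 g0 gB g_out.
have -> : ((A * 2 ^+ N)%:E * energy a = \sum_(j <oo)
    (A * (a j ^+ 2 * (r j ^- 2 + upper j)) * (r j *+ 2) ^+ N)%:E)%E.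
  rewrite -nneseriesZl => [|j _]; last by rewrite lee_fin energy_term_ge0.
  apply: eq_eseriesr => j _; rewrite -EFinM -[r j *+ 2]mulr_natl exprMn.
  by congr (_%:E); rewrite /energy_term; ring.
apply: (intRN_le_nneseries_ball (c := c)) => // [j|x].
  exact: mulr_ge0 A0 (mulr_ge0 (sqr_ge0 _) (weight_ge0 _)).
have [[j xj]|/forallNP/g_out] := pselect (exists j, B j x); last by left.
by right; exists j; [exact: sub_eball_ball | exact: gB].
Qed.

Lemma weighted_bump_sum_sqr_le a j x : B j x ->
  V x * bump_sum a x ^+ 2 <= a j ^+ 2 * upper j.
Proof.
move=> xj; rewrite (bump_sum_in _ xj) exprMn mulrCA ler_wpM2l ?sqr_ge0//.
rewrite -[leRHS]mulr1 ler_pM ?sqr_ge0 ?V_le//.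
by rewrite expr_le1// ?bump_ge0 ?bump_le1.
Qed.

Lemma intRN_weighted_bump_sum_sqr_le a :
  (intRN (fun x => (V x * bump_sum a x ^+ 2)%:E) <= (2 ^+ N)%:E * energy a)%E.
Proof.
rewrite -[(2 ^+ N)]mul1r; apply: intRN_le_energy => // [x|j x xj|x xB].
- by rewrite mulr_ge0 ?sqr_ge0.
- rewrite mul1r (le_trans (weighted_bump_sum_sqr_le a xj))//.
  by rewrite ler_wpM2l ?sqr_ge0// lerDr invr_ge0 sqr_ge0.
- by rewrite bump_sum_out// expr0n mulr0.
Qed.

Lemma normV_sq_bump_sum_le : exists2 A : R, 0 <= A &
  forall a n, vanishing_from n a ->
    (normV_sq V (bump_sum a) <= A%:E * energy a)%E.
Proof.
have [D D0 dbumpD] := @sum_dbump_sqr_le R N.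
exists ((D + 1) * 2 ^+ N) => [|a n a0]; first by rewrite mulr_ge0 ?addr_ge0.
apply: intRN_le_energy => [|x|j x xj|x xB]; first by rewrite addr_ge0.
- rewrite addr_ge0//; first by apply: sumr_ge0 => i _; exact: sqr_ge0.
  by rewrite mulr_ge0 ?sqr_ge0.
- rewrite (grad_sq_bump_sum_in a0 xj) [leRHS]mulrCA.
  apply: le_trans (lerD (ler_wpM2l (sqr_ge0 _) (dbumpD _ _ _ (r_gt0 j)))
    (weighted_bump_sum_sqr_le a xj)) _.
  rewrite -mulrDr ler_wpM2l ?sqr_ge0// mulrDr lerD//.
    by rewrite ler_wpM2r ?invr_ge0 ?sqr_ge0// lerDl.
  by rewrite ler_peMl ?upper_ge0// lerDr.
- by rewrite (grad_sq_bump_sum_out a0 xB) bump_sum_out// expr0n mulr0 addr0.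
Qed.

Lemma energy_term_le a b j : `|b j| <= `|a j| ->
  energy_term b j <= energy_term a j.
Proof.
move=> ba; apply: ler_wpM2r; first by rewrite exprn_ge0// ltW.
apply: ler_wpM2r; first exact: weight_ge0.
rewrite -[leLHS]real_normK ?num_real// -[leRHS]real_normK ?num_real//.
by rewrite ler_sqr ?nnegrE.
Qed.

Lemma energy_le_tail K a b : tail_dominated K a b ->
  (energy b <= \sum_(K <= j <oo) (energy_term a j)%:E)%E.
Proof.
move=> [b0 ba]; rewrite /energy (nneseries_split 0 K) => [|j _]; last first.
  by rewrite lee_fin energy_term_ge0.
rewrite big_nat_cond big1 ?add0e => [|j /andP[/andP[_ jK] _]]; last first.
  by rewrite /energy_term b0// expr0n !mul0r.
apply: lee_nneseries => [j _ _|j _]; rewrite lee_fin ?energy_term_ge0//.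
exact: energy_term_le.
Qed.

Lemma energy_tail_small (A eps : R) a :
  0 <= A -> 0 < eps -> (energy a < +oo)%E ->
  exists K, forall b, tail_dominated K a b -> (A%:E * energy b <= eps%:E)%E.
Proof.
move=> A0 eps0 Ea; have A1 : 0 < A + 1 by rewrite ltr_wpDl.
have tail_cvg0 :
    (\sum_(K <= j <oo) (energy_term a j)%:E)%E @[K --> \oo] --> 0%E.
  by apply: nneseries_tail_cvg Ea _ => j _; rewrite lee_fin energy_term_ge0.
have [|K _ tailK] := tail_cvg0 [set y | (y < (eps / (A + 1))%:E)%E].
  apply: open_nbhs_nbhs; split; first exact: open_ereal_lt_ereal.
  by rewrite /= lte_fin divr_gt0.
exists K => b /energy_le_tail Eb.
have EbK := le_trans Eb (ltW (tailK K (leqnn K))).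
apply: le_trans (lee_wpmul2l _ EbK) _; rewrite ?lee_fin//.
by rewrite mulrCA ler_piMr ?(ltW eps0)// ler_pdivrMr// mul1r lerDl.
Qed.

Lemma H1V_bump_sum a : (energy a < +oo)%E -> H1V V (bump_sum a).
Proof.
move=> Ea; split; first exact: measurableRN_bump_sum.
have [A A0 normA] := normV_sq_bump_sum_le.
exists (fun n => bump_sum (truncate n a)); split.
  by move=> n; exact: Cc_inf_bump_sum (@vanishing_truncate _ n a).
split=> eps eps0.
- have [K EK] := energy_tail_small A0 eps0 Ea.
  exists K => k l Kk Kl; rewrite bump_sumB.
  apply: le_trans (normA _ _ (@vanishing_truncateB _ k l a)) (EK _ _).
  exact: tail_dominated_truncateB.
- have [K EK] := energy_tail_small (exprn_ge0 N (ler0n R 2)) eps0 Ea.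
  exists K => k Kk; under eq_fun do rewrite (congr1 (@^~ _) (bump_sumB _ _)).
  apply: le_trans (intRN_weighted_bump_sum_sqr_le _) (EK _ _).
  exact: tail_dominated_truncate_sub.
Qed.

End FiniteEnergy.

Section LowerBound.
Variables (V : 'rV[R]_N -> R) (lower a : nat -> R) (tau : R).
Hypothesis N_gt0 : (0 < N)%N.
Hypothesis V_ge0 : forall x, 0 <= V x.
Hypothesis lower_ge0 : forall j, 0 <= lower j.
Hypothesis V_ge : forall j x, B j x -> lower j <= V x.
Hypothesis a_ge0 : forall j, 0 <= a j.
Hypothesis tau_ge0 : 0 <= tau.

Lemma intRN_bump_sum_powR_ge : exists2 K : R, 0 < K & forall j,
  ((K * (lower j * a j `^ tau * r j ^+ N))%:E <=
   intRN (fun x => (V x * `|bump_sum a x| `^ tau)%:E))%E.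
Proof.
pose h : R := flat 1 (3 / 4).
have h_gt0 : 0 < h by apply: flat1_gt0; lra.
have sqrtN_gt0 : 0 < Num.sqrt N%:R :> R by rewrite sqrtr_gt0 ltr0n.
exists (h `^ tau / Num.sqrt N%:R ^+ N) => [|j].
  by rewrite divr_gt0 ?powR_gt0 ?exprn_gt0.
pose w := r j / (2 * Num.sqrt N%:R).
have w_gt0 : 0 < w by rewrite divr_gt0 ?mulr_gt0.
have -> : h `^ tau / Num.sqrt N%:R ^+ N * (lower j * a j `^ tau * r j ^+ N) =
    lower j * (a j * h) `^ tau * (w *+ 2) ^+ N.
  rewrite powRM ?(ltW h_gt0)// -[w *+ 2]mulr_natr.
  have -> : w * 2 = r j / Num.sqrt N%:R by rewrite /w; field; rewrite gt_eqF.
  by rewrite expr_div_n; ring.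
apply: (intRN_ge_ball (c := c j)) => // [||x xc].
- by rewrite mulr_ge0 ?powR_ge0.
- by move=> x; rewrite mulr_ge0 ?powR_ge0.
have xhalf : eucl_norm (x - c j) <= r j / 2.
  have <- : Num.sqrt N%:R * w = r j / 2 by rewrite /w; field; rewrite gt_eqF.
  exact: eucl_norm_le_ball.
have xj : B j x.
  by rewrite /eball /= (le_lt_trans xhalf)// ltr_pdivrMr// ltr_pMr// ltr1n.
rewrite ler_pM ?powR_ge0 ?V_ge// ge0_ler_powR ?nnegrE ?mulr_ge0 ?(ltW h_gt0)//.
rewrite (bump_sum_in _ xj) ger0_norm ?mulr_ge0 ?bump_ge0//.
by rewrite ler_wpM2l ?bump_ge_half_radius.
Qed.

Lemma not_LtauV_bump_sum :
  (forall A : R, exists j, A <= lower j * a j `^ tau * r j ^+ N) ->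
  ~ LtauV V tau (bump_sum a).
Proof.
move=> unbounded [_]; have [K K_gt0 intK] := intRN_bump_sum_powR_ge.
rewrite ltNge => /negP; apply; rewrite leye_eq; apply/eqP/eq_infty => t.
have [j tj] := unbounded (t / K); apply: le_trans (intK j).
by rewrite lee_fin mulrC -ler_pdivrMr.
Qed.

End LowerBound.

End DisjointBumps.

Definition scaling_exponent {R : realType} (N : nat) : R := N%:R / 2 - 1.

Lemma scaling_exponent_gt0 {R : realType} (N : nat) :
  (2 < N)%N -> 0 < scaling_exponent N :> R.
Proof. by move=> N2; rewrite subr_gt0 ltr_pdivlMr// mul1r (ltr_nat _ 2). Qed.

Lemma mul_expr_div_sqrt {R : realType} (N : nat) (m v : R) : 0 < v ->
  v * (m / Num.sqrt v) ^+ N = m ^+ N * v `^ (- scaling_exponent N).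
Proof.
move=> v_gt0; have v_ge0 := ltW v_gt0; rewrite expr_div_n -powR12_sqrt//.
rewrite -[(v `^ _) ^+ N]powR_mulrn ?powR_ge0// -powRrM.
rewrite opprB powRD ?(gt_eqF v_gt0) ?implybT// powRr1//.
by rewrite powRN mulrCA [2^-1 * _]mulrC.
Qed.

Section Spikes.
Context {R : realType} {N : nat} (V : 'rV[R]_N -> R) (c : nat -> 'rV[R]_N).
Variables (m alpha : R).
Local Notation v k := (V (c k)).

Definition spike_radius k : R := m / Num.sqrt (v k).

Definition spikes : 'rV[R]_N -> R :=
  bump_sum c spike_radius (fun k => v k `^ alpha).

Variables (c1 c2 : R).
Hypothesis V_gt0 : forall x, 0 < V x.
Hypothesis m_gt0 : 0 < m.
Hypothesis V_comparable : forall k x, eball (c k) (spike_radius k) x ->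
  c1 * v k <= V x /\ V x <= c2 * v k.
Hypothesis v_sparse : forall i k, (i < k)%N -> c2 * v i < c1 * v k.

Let radius_gt0 k : 0 < spike_radius k.
Proof. by rewrite divr_gt0 ?sqrtr_gt0. Qed.

Let disjoint_balls :
  trivIset [set: nat] (fun k => eball (c k) (spike_radius k)).
Proof. exact: trivIset_separated V_comparable v_sparse. Qed.

Lemma energy_term_spikes k :
  @energy_term R N spike_radius (fun k => c2 * v k) (fun k => v k `^ alpha) k =
  (m ^- 2 + c2) * m ^+ N * v k `^ (2 * alpha - scaling_exponent N).
Proof.
rewrite /energy_term (_ : spike_radius k ^- 2 = m ^- 2 * v k); last first.
  by rewrite expr_div_n sqr_sqrtr ?(ltW (V_gt0 _))// invf_div mulrC.
rewrite -mulrDl mulrA -mulrA mul_expr_div_sqrt//.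
rewrite powRD ?(gt_eqF (V_gt0 _)) ?implybT// [2 * alpha]mulrC powRrM.
by rewrite powR_mulrn ?powR_ge0//; ring.
Qed.

Lemma H1V_spikes : 0 <= c2 ->
  (\sum_(k <oo) (v k `^ (2 * alpha - scaling_exponent N))%:E < +oo)%E ->
  H1V V spikes.
Proof.
move=> c2_ge0 sum_lty.
apply: (H1V_bump_sum radius_gt0 disjoint_balls (upper := fun k => c2 * v k)).
- by move=> x; exact: ltW.
- by move=> k x /V_comparable[].
rewrite /energy; under eq_eseriesr do rewrite energy_term_spikes EFinM.
rewrite nneseriesZl => [|k _]; last by rewrite lee_fin powR_ge0.
rewrite lte_mul_pinfty// lee_fin mulr_ge0 ?exprn_ge0 ?(ltW m_gt0)//.
by rewrite addr_ge0// invr_ge0 sqr_ge0.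
Qed.

Lemma not_LtauV_spikes (tau : R) : (0 < N)%N -> 0 < c1 -> 0 <= tau ->
  (forall A, exists k, A <= v k `^ (tau * alpha - scaling_exponent N)) ->
  ~ LtauV V tau spikes.
Proof.
move=> N_gt0 c1_gt0 tau_ge0 unbounded.
apply: (not_LtauV_bump_sum radius_gt0 disjoint_balls
  (lower := fun k => c1 * v k)).
- exact: N_gt0.
- by move=> x; exact: ltW.
- by move=> k; exact: mulr_ge0 (ltW c1_gt0) (ltW (V_gt0 _)).
- by move=> k x /V_comparable[].
- by move=> k; exact: powR_ge0.
- exact: tau_ge0.
move=> A; have c1m_gt0 : 0 < c1 * m ^+ N by rewrite mulr_gt0 ?exprn_gt0.
have [k Ak] := unbounded (A / (c1 * m ^+ N)); exists k.
have -> : c1 * v k * (v k `^ alpha) `^ tau * spike_radius k ^+ N =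
    v k `^ (tau * alpha - scaling_exponent N) * (c1 * m ^+ N).
  rewrite mulrAC -[c1 * v k * _]mulrA mul_expr_div_sqrt// -powRrM.
  by rewrite powRD ?(gt_eqF (V_gt0 _)) ?implybT// [tau * alpha]mulrC; ring.
by rewrite -ler_pdivrMr.
Qed.

End Spikes.

Theorem theorem2p3 (R : realType) (N : nat) (V : 'rV[R]_N -> R)
  (c1 c2 m : R) (xs : nat -> 'rV[R]_N) :
  (3 <= N)%N ->
  continuous V ->
  (exists v0 : R, 0 < v0 /\ forall x, v0 <= V x) ->
  0 < c1 -> 0 < c2 -> 0 < m ->
  (fun n => V (xs n)) @ \oo --> +oo ->
  (forall n x, eucl_norm (x - xs n) < m / Num.sqrt (V (xs n)) ->
      c1 * V (xs n) <= V x /\ V x <= c2 * V (xs n)) ->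
  forall tau : R, 2 < tau ->
    exists u : 'rV[R]_N -> R, H1V V u /\ ~ LtauV V tau u.
Proof.
move=> N3 _ [v0 [v0_gt0 Vv0]] c1_gt0 c2_gt0 m_gt0 Voo V_comparable tau tau2.
have V_gt0 x : 0 < V x by exact: lt_le_trans (Vv0 x).
have [alpha [alpha_lt alpha_gt]] :=
  exists_middle_exponent (scaling_exponent_gt0 (R := R) N3) tau2.
have [f [sum_lty unbounded sparse]] :=
  exists_sparse_subsequence c2 Voo alpha_lt alpha_gt c1_gt0.
have comparable k := V_comparable (f k).
exists (spikes V (xs \o f) m alpha); split.
  exact: H1V_spikes V_gt0 m_gt0 comparable sparse (ltW c2_gt0) sum_lty.
apply: (not_LtauV_spikes V_gt0 m_gt0 comparable sparse) => //.
  exact: leq_trans N3.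
by rewrite ltW// (lt_trans _ tau2).
Qed.
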